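(* Let $B\subset A$ be a pair of regular Lie algebroids over the same regular foliated manifold $(M,F)$, with $\pmb g=\ker\#_A$, $\pmb h=\ker\#_B$, let $L$ be an arbitrary (not necessarily regular) Lie algebroid on $M$, and let $\nabla:L\to A$ be a flat $L$-connection in $A$. Then $\Delta_{(A,B)}$ and $\Delta_{(A,B,\nabla)}$ induce homomorphisms in cohomology $$\Delta_{(A,B)\#}:\mathsf H^\bullet(\pmb g,B)\to\mathsf H^\bullet(A),\qquad \Delta_{(A,B,\nabla)\#}:\mathsf H^\bullet(\pmb g,B)\to\mathsf H^\bullet(L).$$
   Context: A Lie algebroid over $M$ is a vector bundle $L\to M$ with an $\mathbb R$-Lie bracket $[\![\cdot,\cdot]\!]$ on $\Gamma(L)$ and a vector bundle map (anchor) $\#_L:L\to TM$ with $[\![\xi,f\eta]\!]=f[\![\xi,\eta]\!]+(\#_L\xi)(f)\,\eta$. It is regular if $\#_L$ has constant rank; it is over $(M,F)$ if $F=\operatorname{Im}\#_L$. $j:B\hookrightarrow A$ is the inclusion of a Lie subalgebroid. An $L$-connection in $A$ is a vector bundle homomorphism $\nabla:L\to A$ (over $\mathrm{id}_M$) commuting with anchors; it is flat if it preserves brackets. $\mathsf H^\bullet(L)$ denotes the cohomology of $\Omega(L)=\Gamma(\bigwedge L^* )$ with the standard Lie algebroid differential $d_L$ (similarly for $A$). Choose a splitting $\lambda:F\to B$ of $\#_B$, and let $\breve\lambda:A\to\pmb g$, $\breve\lambda(a)=a-j\lambda(\#_Aa)$. Put $\omega_{B,\nabla}:L\to\pmb g/\pmb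 h$, $\omega_{B,\nabla}(w)=[-\breve\lambda(\nabla w)]$ (independent of $\lambda$), and for $\Psi\in\Gamma(\bigwedge^k(\pmb g/\pmb h)^* )$, $w_i\in L_{|x}$, $$(\Delta_{(A,B,\nabla)}\Psi)_x(w_1\wedge\dots\wedge w_k)=\langle\Psi_x,\omega_{B,\nabla}(w_1)\wedge\dots\wedge\omega_{B,\nabla}(w_k)\rangle .$$ $\Delta_{(A,B)}:=\Delta_{(A,B,\mathrm{id}_A)}$ is the case $L=A$, $\nabla=\mathrm{id}_A$. $(\Gamma(\bigwedge(\pmb g/\pmb h)^* ))^{\Gamma(B)}$ consists (in degree $k$) of those $\Psi$ with $(\#_B\circ\xi)\langle\Psi,[\nu_1]\wedge\dots\wedge[\nu_k]\rangle=\sum_{j}(-1)^{j-1}\langle\Psi,[[\![\xi,\nu_j]\!]]\wedge[\nu_1]\wedge\dots\hat\jmath\dots\wedge[\nu_k]\rangle$ for all $\xi\in\Gamma(B)$, $\nu_i\in\Gamma(\pmb g)$. It carries the differential $\langle\bar\delta\Psi,[\nu_1]\wedge\dots\wedge[\nu_k]\rangle=\sum_{i<j}(-1)^{i+j+1}\langle\Psi,[[\![\nu_i,\nu_j]\!]]\wedge[\nu_1]\wedge\dots\hat\imath\dots\hat\jmath\dots\wedge[\nu_k]\rangle$, and $\mathsf H^\bullet(\pmb g,B)$ is its cohomology. The induced maps are those given on representatives by the restrictions of $\Delta_{(A,B)}$ and $\Delta_{(A,B,\nabla)}$ to invariant cross-sections. *)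

(* Defs.v *)
From HB Require Import structures.
From mathcomp Require Import all_boot all_order all_algebra fingroup perm.
From mathcomp Require Import all_classical all_reals all_analysis.
Import Order.TTheory GRing.Theory Num.Theory numFieldNormedType.Exports.
Set Implicit Arguments.
Unset Strict Implicit.
Unset Printing Implicit Defensive.
Local Open Scope classical_set_scope.
Local Open Scope ring_scope.

Section Dprod.
Variables (K : pzRingType) (I : Type) (V : I -> lmodType K).

Definition dprod : Type := forall i, V i.
HB.instance Definition _ := gen_eqMixin dprod.
HB.instance Definition _ := gen_choiceMixin dprod.

Definition dprod_zero : dprod := fun=> 0.
Definition dprod_opp (f : dprod) : dprod := fun i => - f i.
Definition dprod_add (f g : dprod) : dprod := fun i => f i + g i.
Definition dprod_scale (a : K) (f : dprod) : dprod := fun i => a *: f i.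

Fact dprod_addA : associative dprod_add.
Proof. by move=> f g h; apply: functional_extensionality_dep => i; exact: addrA. Qed.
Fact dprod_addC : commutative dprod_add.
Proof. by move=> f g; apply: functional_extensionality_dep => i; exact: addrC. Qed.
Fact dprod_add0 : left_id dprod_zero dprod_add.
Proof. by move=> f; apply: functional_extensionality_dep => i; exact: add0r. Qed.
Fact dprod_addN : left_inverse dprod_zero dprod_opp dprod_add.
Proof. by move=> f; apply: functional_extensionality_dep => i; exact: addNr. Qed.
HB.instance Definition _ :=
  GRing.isZmodule.Build dprod dprod_addA dprod_addC dprod_add0 dprod_addN.

Fact dprod_scaleA a b (f : dprod) : dprod_scale a (dprod_scale b f) = dprod_scale (a * b) f.
Proof. by apply: functional_extensionality_dep => i; exact: scalerA. Qed.
Fact dprod_scale1 : left_id 1 dprod_scale.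
Proof. by move=> f; apply: functional_extensionality_dep => i; exact: scale1r. Qed.
Fact dprod_scaleDr : right_distributive dprod_scale +%R.
Proof. by move=> a f g; apply: functional_extensionality_dep => i; exact: scalerDr. Qed.
Fact dprod_scaleDl (f : dprod) : {morph dprod_scale^~ f : a b / a + b}.
Proof. by move=> a b; apply: functional_extensionality_dep => i; exact: scalerDl. Qed.
HB.instance Definition _ := GRing.Zmodule_isLmodule.Build K dprod
  dprod_scaleA dprod_scale1 dprod_scaleDr dprod_scaleDl.
End Dprod.

Record lsubspace (K : pzRingType) (V : lmodType K) := LSubspace {
  lsubspace_mem :> V -> Prop;
  lsubspace0 : lsubspace_mem 0;
  lsubspaceP : forall a u v,
    lsubspace_mem u -> lsubspace_mem v -> lsubspace_mem (a *: u + v) }.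

Section SubOf.
Variables (K : pzRingType) (V : lmodType K) (W : lsubspace V).

Definition lsubspace_pred : pred V := fun v => `[< W v >].

Record sub_of := SubOf { sub_val :> V; _ : lsubspace_pred sub_val }.
HB.instance Definition _ := [isSub for sub_val].
HB.instance Definition _ := [Choice of sub_of by <:].

Fact lsubspace_closed : submod_closed lsubspace_pred.
Proof.
split; first by apply/asboolP; exact: lsubspace0.
by move=> a u v /asboolP Wu /asboolP Wv; apply/asboolP; exact: lsubspaceP.
Qed.
HB.instance Definition _ := GRing.isSubmodClosed.Build K V lsubspace_pred
  lsubspace_closed.
HB.instance Definition _ := [SubChoice_isSubLmodule of sub_of by <:].

Definition mk_sub v (Wv : W v) : sub_of := SubOf (asboolT Wv).

Lemma sub_ofP (u : sub_of) : W (sub_val u).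
Proof. by apply/asboolP; case: u. Qed.

Lemma sub_val_inj : injective sub_val. Proof. exact: val_inj. Qed.
Lemma sub_val0 : sub_val 0 = 0. Proof. by []. Qed.
Lemma sub_valN u : sub_val (- u) = - sub_val u. Proof. by []. Qed.
Lemma sub_valD u v : sub_val (u + v) = sub_val u + sub_val v. Proof. by []. Qed.
Lemma sub_valZ a u : sub_val (a *: u) = a *: sub_val u. Proof. by []. Qed.
End SubOf.
Arguments sub_of {K V} W.
Arguments mk_sub {K V W v}.

Section QuotBy.
Variables (K : pzRingType) (V : lmodType K) (W : lsubspace V).

Lemma lsubspaceD u v : W u -> W v -> W (u + v).
Proof. by move=> Wu Wv; rewrite -[u]scale1r; exact: lsubspaceP. Qed.
Lemma lsubspaceZ a v : W v -> W (a *: v).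
Proof. by move=> Wv; rewrite -[_ *: _]addr0; apply: lsubspaceP => //; exact: lsubspace0. Qed.
Lemma lsubspaceN v : W v -> W (- v).
Proof. by move=> Wv; rewrite -scaleN1r; exact: lsubspaceZ. Qed.

Definition coset v : set V := [set u | W (u - v)].

Record quot_by := QuotBy { quot_set : set V;
  quot_setP : exists v, quot_set = coset v }.
HB.instance Definition _ := gen_eqMixin quot_by.
HB.instance Definition _ := gen_choiceMixin quot_by.

Definition quot_class v : quot_by := QuotBy (ex_intro _ v erefl).
Definition quot_repr (q : quot_by) : V := projT1 (cid (quot_setP q)).

Lemma quot_eqP u v : quot_class u = quot_class v <-> W (u - v).
Proof.
split=> [[uv]|Wuv].
  have : coset u u by rewrite /coset /= subrr; exact: lsubspace0.
  by rewrite uv.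
have E : coset u = coset v.
  apply/seteqP; split=> w; rewrite /coset /= => Ww.
    by rewrite -(subrKA u); exact: lsubspaceD.
  rewrite (_ : w - u = (w - v) + - (u - v)); last by rewrite opprB subrKA.
  by apply: lsubspaceD => //; exact: lsubspaceN.
rewrite /quot_class; move: (ex_intro _ _ _) (ex_intro _ _ _); rewrite E => p q.
by congr QuotBy; exact: Prop_irrelevance.
Qed.

Lemma quot_reprK q : quot_class (quot_repr q) = q.
Proof.
case: q => S p; rewrite /quot_repr /=; case: (cid _) => v /= E; subst S.
by congr QuotBy; exact: Prop_irrelevance.
Qed.

Lemma quot_reprP v : W (quot_repr (quot_class v) - v).
Proof. by apply/quot_eqP; rewrite quot_reprK. Qed.

Definition quot_zero := quot_class 0.
Definition quot_opp q := quot_class (- quot_repr q).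
Definition quot_add p q := quot_class (quot_repr p + quot_repr q).
Definition quot_scale a q := quot_class (a *: quot_repr q).

Lemma quot_oppE v : quot_opp (quot_class v) = quot_class (- v).
Proof. by apply/quot_eqP; rewrite -opprD; apply: lsubspaceN; exact: quot_reprP. Qed.
Lemma quot_addE u v :
  quot_add (quot_class u) (quot_class v) = quot_class (u + v).
Proof.
by apply/quot_eqP; rewrite opprD addrACA; apply: lsubspaceD; exact: quot_reprP.
Qed.
Lemma quot_scaleE a v : quot_scale a (quot_class v) = quot_class (a *: v).
Proof. by apply/quot_eqP; rewrite -scalerBr; apply: lsubspaceZ; exact: quot_reprP. Qed.

Fact quot_addA : associative quot_add.
Proof.
move=> p q r; rewrite -(quot_reprK p) -(quot_reprK q) -(quot_reprK r).
by rewrite !quot_addE addrA.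
Qed.
Fact quot_addC : commutative quot_add.
Proof. by move=> p q; rewrite /quot_add addrC. Qed.
Fact quot_add0 : left_id quot_zero quot_add.
Proof. by move=> p; rewrite -(quot_reprK p) quot_addE add0r. Qed.
Fact quot_addN : left_inverse quot_zero quot_opp quot_add.
Proof. by move=> p; rewrite -(quot_reprK p) quot_oppE quot_addE addNr. Qed.
HB.instance Definition _ :=
  GRing.isZmodule.Build quot_by quot_addA quot_addC quot_add0 quot_addN.

Fact quot_scaleA a b q : quot_scale a (quot_scale b q) = quot_scale (a * b) q.
Proof. by rewrite -(quot_reprK q) !quot_scaleE scalerA. Qed.
Fact quot_scale1 : left_id 1 quot_scale.
Proof. by move=> q; rewrite -(quot_reprK q) quot_scaleE scale1r. Qed.
Fact quot_scaleDr : right_distributive quot_scale +%R.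
Proof.
move=> a p q; rewrite -(quot_reprK p) -(quot_reprK q) [_ + _]quot_addE.
by rewrite !quot_scaleE [RHS]quot_addE scalerDr.
Qed.
Fact quot_scaleDl q : {morph quot_scale^~ q : a b / a + b}.
Proof.
move=> a b; rewrite -(quot_reprK q) !quot_scaleE [RHS]quot_addE.
by rewrite scalerDl.
Qed.
HB.instance Definition _ := GRing.Zmodule_isLmodule.Build K quot_by
  quot_scaleA quot_scale1 quot_scaleDr quot_scaleDl.

Fact quot_class_linear : linear quot_class.
Proof. by move=> a u v; rewrite -quot_addE -quot_scaleE. Qed.
HB.instance Definition _ :=
  GRing.isLinear.Build K V quot_by *:%R quot_class quot_class_linear.
End QuotBy.
Arguments quot_by {K V} W.
Arguments quot_class {K V} W v.

Section Alternating.
Variables (K : comNzRingType) (V : lmodType K) (k : nat).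
Implicit Types (phi : ('I_k -> V) -> K^o) (w : 'I_k -> V).

Definition update w (i : 'I_k) (v : V) : 'I_k -> V :=
  fun j => if j == i then v else w j.

Definition is_alternating phi :=
  (forall w i a u v, phi (update w i (a *: u + v)) =
     a *: phi (update w i u) + phi (update w i v)) /\
  (forall w i j, i != j -> w i = w j -> phi w = 0).

Fact alternating0 : is_alternating 0.
Proof. by split=> *; rewrite ?scaler0 ?addr0. Qed.
Fact alternatingP a phi psi :
  is_alternating phi -> is_alternating psi -> is_alternating (a *: phi + psi).
Proof.
move=> [lphi aphi] [lpsi apsi]; split=> [w i b u v|w i j ij wij].
  change (a *: phi (update w i (b *: u + v)) + psi (update w i (b *: u + v))
    = b *: (a *: phi (update w i u) + psi (update w i u)) +
      (a *: phi (update w i v) + psi (update w i v))).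
  rewrite lphi lpsi !scalerDr !scalerA [b * a]mulrC.
  by rewrite -!addrA; congr (_ + _); rewrite addrCA.
change (a *: phi w + psi w = 0).
by rewrite (aphi w i j)// (apsi w i j)// scaler0 addr0.
Qed.

Definition alt_space : lsubspace (('I_k -> V) -> K^o) :=
  LSubspace alternating0 alternatingP.
Definition alt : lmodType K := sub_of alt_space.
End Alternating.
Arguments alt_space {K} V k.

(** The family (v, w_0, ..., w_{k-2}). *)
Definition consf (T : Type) k (v : T) (w : 'I_k.-1 -> T) : 'I_k -> T :=
  fun i => if (i : nat) is i'.+1 then oapp w v (insub i') else v.

(** Normalised so that (a1 /\ ... /\ ak)(v1, ..., vk) = det (ai vj). *)
Definition wedge (K : fieldType) (V : lmodType K) k l
    (phi : alt V k) (psi : alt V l) : ('I_(k + l) -> V) -> K^o :=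
  fun w => (k`! * l`!)%:R^-1 * \sum_(s : 'S_(k + l)) (-1) ^+ s *
    ((sub_val phi (fun i => w (s (lshift l i))) : K) *
     sub_val psi (fun i => w (s (rshift k i)))).

Definition has_dim (K : pzRingType) (V : lmodType K) (W : V -> Prop) (r : nat) :=
  exists b : 'I_r -> V,
    (forall v, W v <-> exists c : 'I_r -> K, v = \sum_i c i *: b i) /\
    (forall c : 'I_r -> K, \sum_i c i *: b i = 0 -> forall i, c i = 0).

Section SmoothOn.
Variables (R : realType) (n : nat).
Implicit Types (U : set 'rV[R]_n) (f g : 'rV[R]_n -> R).

Fixpoint Cn_on (k : nat) U f : Prop :=
  (forall x, U x -> {for x, continuous f}) /\
  if k is k'.+1 then
    forall i : 'I_n, (forall x, U x -> derivable f x (delta_mx 0 i)) /\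
      Cn_on k' U (fun x => 'D_(delta_mx 0 i) f x)
  else True.

Definition Cinf_on U f := forall k, Cn_on k U f.

Lemma Cn_on_sub k U U' f : U' `<=` U -> Cn_on k U f -> Cn_on k U' f.
Proof.
elim: k f => [|k IH] f UU' /= [cf df].
  by split=> // x /UU'; exact: cf.
split=> [x /UU'|i]; first exact: cf.
by have [dfi Cf] := df i; split=> [x /UU'|]; [exact: dfi|exact: IH].
Qed.

Lemma Cn_on_ext k U f g : open U -> (forall x, U x -> f x = g x) ->
  Cn_on k U f -> Cn_on k U g.
Proof.
move=> oU; elim: k f g => [|k IH] f g fg /= [cf df].
  split=> // x Ux; have nfg : {near x, f =1 g}.
    by apply: filterS fg _; exact: open_nbhs_nbhs.
  rewrite /prop_for /continuous_at -fg//; apply: cvg_trans (cf x Ux).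
  exact: near_eq_cvg nfg.
have nfg x : U x -> {near x, f =1 g}.
  by move=> Ux; apply: filterS fg _; exact: open_nbhs_nbhs.
split=> [x Ux|i].
  rewrite /prop_for /continuous_at -fg//; apply: cvg_trans (cf x Ux).
  exact: near_eq_cvg (nfg x Ux).
have [dfi Cf] := df i; split=> [x Ux|].
  exact: near_eq_derivable (nfg x Ux) (dfi x Ux).
apply: IH Cf => x Ux; apply: near_eq_derive; exact: nfg.
Qed.

Lemma Cn_on_le k U f : Cn_on k.+1 U f -> Cn_on k U f.
Proof.
elim: k f => [|k IH] f [cf df]; split=> // i.
by have [dfi Cf] := df i; split=> //; exact: IH.
Qed.

Lemma Cn_on_cst k U c : Cn_on k U (fun=> c).
Proof.
elim: k c => [|k IH] c /=; first by split=> // x _; exact: cst_continuous.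
split=> [x _|i]; first exact: cst_continuous.
split=> [x _|]; first exact: derivable_cst.
have -> : (fun x : 'rV[R]_n => 'D_(delta_mx 0 i) (fun=> c) x) = (fun=> 0); last exact: IH.
by apply/funext => x; exact: derive_cst.
Qed.

Lemma Cn_onD k U f g : open U ->
  Cn_on k U f -> Cn_on k U g -> Cn_on k U (f \+ g).
Proof.
move=> oU; elim: k f g => [|k IH] f g /= [cf df] [cg dg].
  by split=> // x Ux; exact: (continuousD (cf x Ux) (cg x Ux)).
split=> [x Ux|i]; first by exact: (continuousD (cf x Ux) (cg x Ux)).
have [dfi Cf] := df i; have [dgi Cg] := dg i.
split=> [x Ux|]; first by apply: derivableD; [exact: dfi|exact: dgi].
apply: Cn_on_ext (IH _ _ Cf Cg) => // x Ux.
by rewrite [RHS]deriveD//; [exact: dfi|exact: dgi].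
Qed.

Lemma Cn_onM k U f g : open U ->
  Cn_on k U f -> Cn_on k U g -> Cn_on k U (f \* g).
Proof.
move=> oU; elim: k f g => [|k IH] f g Cf0 Cg0.
  by split=> // x Ux; exact: (continuousM (Cf0.1 x Ux) (Cg0.1 x Ux)).
have [cf df] := Cf0; have [cg dg] := Cg0.
split=> [x Ux|i]; first by exact: (continuousM (cf x Ux) (cg x Ux)).
have [dfi Cf] := df i; have [dgi Cg] := dg i.
split=> [x Ux|]; first by apply: derivableM; [exact: dfi|exact: dgi].
have Cfg := Cn_onD oU (IH _ _ (Cn_on_le Cf0) Cg) (IH _ _ (Cn_on_le Cg0) Cf).
apply: Cn_on_ext Cfg => // x Ux.
by rewrite [RHS]deriveM//; [exact: dfi|exact: dgi].
Qed.
End SmoothOn.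

Section Manifold.
Variables (R : realType) (n : nat) (T : topologicalType).

(** Only the values of [chart_inv] on the image of the chart matter. *)
Record chart := Chart {
  chart_dom : set T;
  chart_map : T -> 'rV[R]_n;
  chart_inv : 'rV[R]_n -> T;
  chart_dom_open : open chart_dom;
  chart_img_open : open (chart_map @` chart_dom);
  chart_map_cont : forall x, chart_dom x -> {for x, continuous chart_map};
  chart_inv_cont : forall y, (chart_map @` chart_dom) y ->
    {for y, continuous chart_inv};
  chart_mapK : forall x, chart_dom x -> chart_inv (chart_map x) = x }.

Definition chart_compat (c d : chart) := forall j : 'I_n,
  Cinf_on (chart_map c @` (chart_dom c `&` chart_dom d))
    (fun y => chart_map d (chart_inv c y) 0 j).
End Manifold.

Record manifold (R : realType) := Manifold {
  mspace :> topologicalType;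
  mdim : nat;
  mspace_hausdorff : hausdorff_space mspace;
  mspace_countable : @second_countable mspace;
  matlas : set (chart R mdim mspace);
  matlas_cover : forall x, exists2 c, matlas c & chart_dom c x;
  matlas_compat : forall c d, matlas c -> matlas d -> chart_compat c d }.

Section SmoothFunctions.
Variables (R : realType) (M : manifold R).

Definition smooth_on (U : set M) (f : M -> R) := forall c, matlas c ->
  Cinf_on (chart_map c @` (chart_dom c `&` U)) (f \o chart_inv c).

Lemma chart_image_open (c : chart R (mdim M) M) (U : set M) :
  open U -> open (chart_map c @` (chart_dom c `&` U)).
Proof.
move=> oU; rewrite openE => y [x [cx Ux] <-]; rewrite /interior.
have yI : (chart_map c @` chart_dom c) (chart_map c x) by exists x.
have h1 : nbhs (chart_map c x) (chart_map c @` chart_dom c).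
  by apply: open_nbhs_nbhs; split=> //; exact: chart_img_open.
have h2 : nbhs (chart_map c x) (chart_inv c @^-1` U).
  apply: (chart_inv_cont yI); rewrite chart_mapK//.
  exact: open_nbhs_nbhs.
apply: filterS2 h1 h2 => z [t ct <-] /=; rewrite chart_mapK// => Ut.
by exists t.
Qed.

Lemma smooth_on_sub U V f : V `<=` U -> smooth_on U f -> smooth_on V f.
Proof.
move=> VU sf c Mc k; apply: Cn_on_sub (sf c Mc k).
by apply: image_subset; exact: setIS.
Qed.

Lemma smooth_on_ext U f g : open U -> (forall x, U x -> f x = g x) ->
  smooth_on U f -> smooth_on U g.
Proof.
move=> oU fg sf c Mc k; apply: Cn_on_ext (sf c Mc k).
  exact: chart_image_open.
by move=> _ [x [cx Ux] <-] /=; rewrite chart_mapK//; exact: fg.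
Qed.

Lemma smooth_on_cst U a : smooth_on U (fun=> a).
Proof. by move=> c _ k; exact: Cn_on_cst. Qed.

Lemma smooth_onD U f g : open U ->
  smooth_on U f -> smooth_on U g -> smooth_on U (fun x => f x + g x).
Proof.
move=> oU sf sg c Mc k.
exact (Cn_onD (chart_image_open (c := c) oU) (sf c Mc k) (sg c Mc k)).
Qed.

Lemma smooth_onM U f g : open U ->
  smooth_on U f -> smooth_on U g -> smooth_on U (fun x => f x * g x).
Proof.
move=> oU sf sg c Mc k.
exact (Cn_onM (chart_image_open (c := c) oU) (sf c Mc k) (sg c Mc k)).
Qed.

Lemma smooth_on0 U : smooth_on U (0 : M -> R^o).
Proof. exact: smooth_on_cst. Qed.

Lemma smooth_onP U a (f g : M -> R^o) : open U ->
  smooth_on U f -> smooth_on U g -> smooth_on U (a *: f + g).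
Proof.
move=> oU sf sg; apply: (@smooth_onD U (fun x => a * f x) g oU _ sg).
by apply: smooth_onM => //; exact: smooth_on_cst.
Qed.

Definition smooth_fun_space : lsubspace (M -> R^o) :=
  LSubspace (@smooth_on0 setT) (fun a u v => @smooth_onP setT a u v openT).
Definition Cinf : lmodType R := sub_of smooth_fun_space.

Lemma Cinf_mul_subproof (f g : Cinf) :
  smooth_on setT (fun x => (sub_val f x : R) * sub_val g x).
Proof. exact (smooth_onM openT (sub_ofP f) (sub_ofP g)). Qed.
Definition Cinf_mul (f g : Cinf) : Cinf :=
  mk_sub (W := smooth_fun_space) (Cinf_mul_subproof f g).

Definition is_derivation (x : M) (D : Cinf -> R^o) :=
  (forall a f g, D (a *: f + g) = a *: D f + D g) /\
  (forall f g, D (Cinf_mul f g) = sub_val f x *: D g + sub_val g x *: D f).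

Fact derivation0 x : is_derivation x 0.
Proof. by split=> *; rewrite ?scaler0 ?addr0. Qed.
Fact derivationP x a D E :
  is_derivation x D -> is_derivation x E -> is_derivation x (a *: D + E).
Proof.
move=> [lD pD] [lE pE]; split=> [b f g|f g].
  change (a *: D (b *: f + g) + E (b *: f + g) =
    b *: (a *: D f + E f) + (a *: D g + E g)).
  rewrite lD lE !scalerDr !scalerA [b * a]mulrC.
  by rewrite -!addrA; congr (_ + _); rewrite addrCA.
change (a *: D (Cinf_mul f g) + E (Cinf_mul f g) =
    sub_val f x *: (a *: D g + E g) + sub_val g x *: (a *: D f + E f)).
rewrite pD pE !scalerDr !scalerA [a * sub_val f x]mulrC [a * sub_val g x]mulrC.
by rewrite -!addrA; congr (_ + _); rewrite addrCA.
Qed.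
Definition derivations x : lsubspace (Cinf -> R^o) :=
  LSubspace (derivation0 x) (@derivationP x).

Definition tangent (x : M) : lmodType R := sub_of (derivations x).

(** Cross-sections of TM, and below vector bundle maps and forms, are called
    smooth when they send smooth data to smooth data. As smooth functions and
    vectors extend globally from a neighbourhood of a point, this is smoothness
    in local coordinates. *)
Definition smooth_vf (X : dprod tangent) :=
  forall f : Cinf, smooth_on setT (fun x => sub_val (X x) f).

Fact smooth_vf0 : smooth_vf 0.
Proof. by move=> f; exact: smooth_on_cst. Qed.
Fact smooth_vfP a X Y : smooth_vf X -> smooth_vf Y -> smooth_vf (a *: X + Y).
Proof. by move=> sX sY f; exact: (smooth_onP a openT (sX f) (sY f)). Qed.
Definition vf_space : lsubspace (dprod tangent) := LSubspace smooth_vf0 smooth_vfP.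
Definition vector_field : lmodType R := sub_of vf_space.

Definition vf_apply (X : vector_field) (f : Cinf) : Cinf :=
  mk_sub (W := smooth_fun_space) (sub_ofP X f).
End SmoothFunctions.
Arguments vf_space {R} M.

Record foliation (R : realType) (M : manifold R) := Foliation {
  fol :> forall x : M, lsubspace (tangent x);
  fol_rank : exists r, forall x, has_dim (fol x) r;
  fol_smooth : forall x (v : tangent x), fol x v ->
    exists2 X : vector_field M, (forall y, fol y (sub_val X y)) & sub_val X x = v;
  fol_involutive : forall X Y Z : vector_field M,
    (forall x, fol x (sub_val X x)) -> (forall x, fol x (sub_val Y x)) ->
    (forall f, vf_apply Z f =
       vf_apply X (vf_apply Y f) - vf_apply Y (vf_apply X f)) ->
    forall x, fol x (sub_val Z x) }.

Section Bundles.
Variables (R : realType) (M : manifold R).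

(** A local trivialisation over [triv_dom]; values of the maps outside
    [triv_dom] are irrelevant. *)
Record trivialisation (E : M -> lmodType R) (r : nat) := Trivialisation {
  triv_dom : set M;
  triv_dom_open : open triv_dom;
  triv_map : forall x, {linear E x -> 'rV[R]_r};
  triv_inv : forall x, 'rV[R]_r -> E x;
  triv_mapK : forall x, triv_dom x -> cancel (triv_map x) (triv_inv x);
  triv_invK : forall x, triv_dom x -> cancel (triv_inv x) (triv_map x) }.

(** The total space is the one glued from the trivialisations. *)
Record bundle := Bundle {
  fibre :> M -> lmodType R;
  brank : nat;
  btriv : set (trivialisation fibre brank);
  btriv_cover : forall x, exists2 t, btriv t & triv_dom t x;
  btriv_compat : forall t u, btriv t -> btriv u -> forall i j : 'I_brank,
    smooth_on (triv_dom t `&` triv_dom u)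
      (fun x => triv_map u x (triv_inv t x (delta_mx 0 i)) 0 j) }.

Section Sections.
Variable E : bundle.

Definition smooth_sec (s : dprod E) := forall t, btriv t -> forall j,
  smooth_on (triv_dom t) (fun x => triv_map t x (s x) 0 j).

Fact smooth_sec0 : smooth_sec 0.
Proof.
move=> t _ j; rewrite (_ : (fun x => _) = fun=> 0); first exact: smooth_on_cst.
by apply/funext => x; rewrite linear0 mxE.
Qed.
Fact smooth_secP a s s' :
  smooth_sec s -> smooth_sec s' -> smooth_sec (a *: s + s').
Proof.
move=> ss ss' t Mt j.
rewrite (_ : (fun x => _) = a *: ((fun x => triv_map t x (s x) 0 j) : M -> R^o)
    + (fun x => triv_map t x (s' x) 0 j)).
  by apply: smooth_onP; [exact: triv_dom_open|exact: ss|exact: ss'].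
by apply/funext => x; rewrite linearP !mxE.
Qed.
Definition sections : lsubspace (dprod E) := LSubspace smooth_sec0 smooth_secP.
Definition Gamma : lmodType R := sub_of sections.

Lemma sec_mul_subproof (f : Cinf M) (s : Gamma) :
  smooth_sec (fun x => sub_val f x *: sub_val s x).
Proof.
move=> t Mt j.
rewrite (_ : (fun x => _) = fun x => sub_val f x * triv_map t x (sub_val s x) 0 j).
  apply: smooth_onM; first exact: triv_dom_open.
    exact (smooth_on_sub (@subsetT _ _) (sub_ofP f)).
  exact (sub_ofP s t Mt j).
by apply/funext => x; rewrite linearZ mxE.
Qed.
Definition sec_mul (f : Cinf M) (s : Gamma) : Gamma :=
  mk_sub (W := sections) (sec_mul_subproof f s).
End Sections.

Record bundle_map (E E' : bundle) := BundleMap {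
  bmap :> forall x, {linear E x -> E' x};
  bmap_smooth : forall s : Gamma E, smooth_sec (fun x => bmap x (sub_val s x)) }.

Definition sec_map E E' (h : bundle_map E E') (s : Gamma E) : Gamma E' :=
  mk_sub (W := sections E') (bmap_smooth h s).

Lemma id_map_smooth (E : bundle) (s : Gamma E) :
  smooth_sec (fun x => (idfun : {linear E x -> E x}) (sub_val s x)).
Proof. exact: (sub_ofP s). Qed.
Definition id_map (E : bundle) : bundle_map E E := BundleMap (@id_map_smooth E).
End Bundles.

(** That the anchor preserves brackets follows from the axioms
    ([anchor_bracket] below). *)
Record lie_algebroid (R : realType) (M : manifold R) := LieAlgebroid {
  la_bundle :> bundle M;
  anchor : forall x, {linear la_bundle x -> tangent x};
  anchor_smooth : forall s : Gamma la_bundle,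
    smooth_vf (fun x => anchor x (sub_val s x));
  bracket : Gamma la_bundle -> Gamma la_bundle -> Gamma la_bundle;
  bracketP : forall s a t u,
    bracket s (a *: t + u) = a *: bracket s t + bracket s u;
  bracketC : forall s t, bracket s t = - bracket t s;
  bracket_jacobi : forall s t u, bracket s (bracket t u) +
    bracket t (bracket u s) + bracket u (bracket s t) = 0;
  bracket_leibniz : forall s f t, bracket s (sec_mul f t) =
    sec_mul f (bracket s t) +
    sec_mul (vf_apply (mk_sub (W := vf_space M) (anchor_smooth s)) f) t }.

Section LieAlgebroid.
Variables (R : realType) (M : manifold R) (L : lie_algebroid M).

Definition anchor_vf (s : Gamma L) : vector_field M :=
  mk_sub (W := vf_space M) (anchor_smooth s).

Lemma bracket0r (s : Gamma L) : bracket s 0 = 0.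
Proof. by have := bracketP s (-1) 0 0; rewrite scaler0 addr0 scaleN1r addNr. Qed.
Lemma bracketNr (s t : Gamma L) : bracket s (- t) = - bracket s t.
Proof. by have := bracketP s (-1) t 0; rewrite !addr0 bracket0r addr0 !scaleN1r. Qed.
Lemma bracketDr (s t u : Gamma L) : bracket s (t + u) = bracket s t + bracket s u.
Proof. by have := bracketP s 1 t u; rewrite !scale1r. Qed.

Lemma bracket_jacobiB (s t u : Gamma L) : bracket (bracket s t) u =
  bracket s (bracket t u) - bracket t (bracket s u).
Proof.
have := bracket_jacobi s t u.
rewrite (bracketC u s) bracketNr (bracketC u (bracket s t)) => /eqP.
by rewrite subr_eq0 => /eqP.
Qed.

Lemma anchor_bracket (s t : Gamma L) (f : Cinf M) :
  vf_apply (anchor_vf (bracket s t)) f =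
  vf_apply (anchor_vf s) (vf_apply (anchor_vf t) f) -
  vf_apply (anchor_vf t) (vf_apply (anchor_vf s) f).
Proof.
set g := vf_apply (anchor_vf (bracket s t)) f.
set h := vf_apply _ (vf_apply _ f); set k := vf_apply (anchor_vf t) _.
apply: sub_val_inj; apply/funext => x.
change (sub_val g x = sub_val h x - sub_val k x :> R).
have key (u : Gamma L) :
    (sub_val g x - (sub_val h x - sub_val k x) : R) *: sub_val u x = 0.
  have := bracket_jacobiB s t (sec_mul f u).
  rewrite !bracket_leibniz !bracketDr !bracket_leibniz bracket_jacobiB.
  rewrite -!/(anchor_vf _) -/g -/h -/k.
  pose ev (v : Gamma L) : L x := sub_val v x.
  have evD v w : ev (v + w) = ev v + ev w by [].
  have evN v : ev (- v) = - ev v by [].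
  have evM c v : ev (sec_mul c v) = sub_val c x *: ev v by [].
  move/(congr1 ev); rewrite !(evD, evN, evM) -/(ev u).
  have E (P Q A B H K : L x) :
      P + A + (B + H) - (Q + B + (A + K)) = P - Q + (H - K).
    rewrite [B + H]addrC [P + _ + _]addrACA [A + K]addrC [Q + _ + _]addrACA.
    by rewrite [B + A]addrC opprD [LHS]addrACA subrr addr0 opprD addrACA.
  rewrite scalerBr E => /addrI gE.
  by rewrite scalerBl gE scalerBl subrr.
have [[u ux]|zero] := pselect (exists u : Gamma L, sub_val u x != 0).
  apply/eqP; rewrite -subr_eq0; have /eqP := key u.
  by rewrite scaler_eq0 (negbTE ux) orbF.
have z (u : Gamma L) : sub_val u x = 0.
  by apply/eqP/negPn/negP => ux; apply: zero; exists u.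
have az (u : Gamma L) e : sub_val (vf_apply (anchor_vf u) e) x = 0.
  by rewrite /= z linear0.
by rewrite !az subrr.
Qed.

(** [isotropy x] is the fibre at x of ker #_L, and [Gamma_ker] the module of
    cross-sections of ker #_L. *)
Fact isotropy0 x : anchor L x 0 = 0. Proof. exact: linear0. Qed.
Fact isotropyP x a u v : anchor L x u = 0 -> anchor L x v = 0 ->
  anchor L x (a *: u + v) = 0.
Proof. by move=> u0 v0; rewrite linearP u0 v0 scaler0 addr0. Qed.
Definition isotropy_space x : lsubspace (L x) :=
  LSubspace (isotropy0 x) (@isotropyP x).
Definition isotropy x : lmodType R := sub_of (isotropy_space x).

Definition in_ker (s : Gamma L) := forall x, isotropy_space x (sub_val s x).
Fact ker_sections0 : in_ker 0.
Proof. by move=> x; exact: lsubspace0. Qed.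
Fact ker_sectionsP a s t : in_ker s -> in_ker t -> in_ker (a *: s + t).
Proof. by move=> s0 t0 x; exact (lsubspaceP a (s0 x) (t0 x)). Qed.
Definition ker_sections : lsubspace (Gamma L) :=
  LSubspace ker_sections0 ker_sectionsP.
Definition Gamma_ker : lmodType R := sub_of ker_sections.

Definition ker_val (nu : Gamma_ker) x : isotropy x :=
  mk_sub (W := isotropy_space x) (sub_ofP nu x).

Lemma bracket_ker_subproof (s : Gamma L) (nu : Gamma_ker) :
  ker_sections (bracket s (sub_val nu)).
Proof.
move=> x; apply: sub_val_inj; apply/funext => f.
have nu0 g : vf_apply (anchor_vf (sub_val nu)) g = 0.
  apply: sub_val_inj; apply/funext => y.
  by rewrite /= (sub_ofP nu y).
have := anchor_bracket s (sub_val nu) f; rewrite !nu0 subr0.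
move/(congr1 (fun h : Cinf M => (sub_val h : M -> R^o) x)) => /= ->.
have [+ _] := sub_ofP (anchor L x (sub_val s x)).
by move=> /(_ (-1) 0 0); rewrite scaler0 addr0 scaleN1r addNr => ->.
Qed.
Definition bracket_ker (s : Gamma L) (nu : Gamma_ker) : Gamma_ker :=
  mk_sub (W := ker_sections) (bracket_ker_subproof s nu).

Definition regular_algebroid := exists r : nat,
  forall x, has_dim (fun v => exists a, anchor L x a = v) r.

Definition over_foliation (F : foliation M) :=
  forall x v, F x v <-> exists a, anchor L x a = v.
End LieAlgebroid.

Section Connections.
Variables (R : realType) (M : manifold R).

Record connection (L A : lie_algebroid M) := Connection {
  conn_map :> bundle_map L A;
  conn_anchor : forall x w, anchor A x (conn_map x w) = anchor L x w }.

Definition flat (L A : lie_algebroid M) (nabla : bundle_map L A) :=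
  forall s t : Gamma L,
    sec_map nabla (bracket s t) = bracket (sec_map nabla s) (sec_map nabla t).

Definition id_conn (A : lie_algebroid M) : connection A A :=
  @Connection A A (id_map A) (fun x w => erefl).

Record lie_subalgebroid (A : lie_algebroid M) := LieSubalgebroid {
  subalg :> lie_algebroid M;
  sub_incl : bundle_map subalg A;
  incl_inj : forall x, injective (sub_incl x);
  incl_anchor : forall x b, anchor A x (sub_incl x b) = anchor subalg x b;
  incl_bracket : flat sub_incl }.

(** A splitting F -> B of the anchor of a Lie algebroid B over (M, F). *)
Record splitting (F : foliation M) (B : lie_algebroid M) := Splitting {
  split_map :> forall x, {linear sub_of (F x) -> B x};
  split_smooth : forall X : dprod (fun x => sub_of (F x)),
    smooth_vf (fun x => sub_val (X x)) ->
    smooth_sec (fun x => split_map x (X x));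
  split_anchor : forall x v, anchor B x (split_map x v) = sub_val v }.
End Connections.

(** Differential, product and unit are given by their graphs: [cd u v] means
    that v is the differential of u. Cohomology is formed as cocycles modulo
    the coboundaries among them, so no totality proof is needed. *)
Record cochain_algebra (K : pzRingType) := CochainAlgebra {
  cc :> nat -> lmodType K;
  cd : forall k, cc k -> cc k.+1 -> Prop;
  cd0 : forall k, @cd k 0 0;
  cdP : forall k a u u' v v',
    @cd k u u' -> @cd k v v' -> @cd k (a *: u + v) (a *: u' + v');
  cmul : forall k l, cc k -> cc l -> cc (k + l) -> Prop;
  cone : cc 0 -> Prop }.

Section Cohomology.
Variables (K : pzRingType) (C : cochain_algebra K).

Fact cocycleP k a (u v : C k) : cd u 0 -> cd v 0 -> cd (a *: u + v) 0.
Proof. by move=> du dv; have := cdP a du dv; rewrite scaler0 addr0. Qed.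
Definition cocycles k : lsubspace (C k) := 
  @LSubspace K (C k) (fun u => cd u 0) (cd0 C k) (@cocycleP k).
Definition cocycle k : lmodType K := sub_of (cocycles k).

Definition is_coboundary k : C k -> Prop :=
  match k return C k -> Prop with
  | 0 => fun u => u = 0
  | k'.+1 => fun u => exists t : C k', cd t u
  end.
Fact coboundary0 k : is_coboundary (sub_val (0 : cocycle k)).
Proof. by case: k => [|k] //=; exists 0; exact: cd0. Qed.
Fact coboundaryP k a (u v : cocycle k) : is_coboundary (sub_val u) ->
  is_coboundary (sub_val v) -> is_coboundary (sub_val (a *: u + v)).
Proof.
case: k u v => [|k] u v /=; first by move=> -> ->; rewrite scaler0 addr0.
by move=> [s ds] [t dt]; exists (a *: s + t); exact: cdP.
Qed.
Definition coboundaries k : lsubspace (cocycle k) :=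
  @LSubspace K (cocycle k) (fun z => is_coboundary (sub_val z))
    (coboundary0 k) (@coboundaryP k).

Definition cohomology k : lmodType K := quot_by (coboundaries k).
Definition coclass k (z : cocycle k) : cohomology k :=
  quot_class (coboundaries k) z.

(** The graph of the product induced on cohomology classes. *)
Definition cup k l (c : cohomology k) (d : cohomology l)
    (e : cohomology (k + l)) := exists z z' z'',
  [/\ coclass z = c, coclass z' = d, coclass z'' = e &
      cmul (sub_val z) (sub_val z') (sub_val z'')].
Definition is_unit (c : cohomology 0) :=
  exists2 z : cocycle 0, coclass z = c & cone (sub_val z).
End Cohomology.

(** [Delta] induces a homomorphism of graded algebras in cohomology. *)
Definition induces_hom (K : pzRingType) (C D : cochain_algebra K)
    (Delta : forall k, C k -> D k) :=
  exists h : forall k, {linear cohomology C k -> cohomology D k},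
    [/\ forall k (z : cocycle C k), exists z' : cocycle D k,
          sub_val z' = Delta k (sub_val z) /\ h k (coclass z) = coclass z',
        forall k l c d e, @cup K C k l c d e -> @cup K D k l (h k c) (h l d) (h (k + l)%N e)
      & forall c, @is_unit K C c -> @is_unit K D (h 0 c)].

Section VfApply.
Variables (R : realType) (M : manifold R).
Lemma vf_applyP (X : vector_field M) a f g :
  vf_apply X (a *: f + g) = a *: vf_apply X f + vf_apply X g.
Proof.
apply: sub_val_inj; apply/funext => x.
exact: ((sub_ofP (sub_val X x)).1 a f g).
Qed.
Lemma vf_apply0 (X : vector_field M) : vf_apply X 0 = 0.
Proof. by have := vf_applyP X (-1) 0 0; rewrite scaler0 addr0 scaleN1r addNr. Qed.
End VfApply.

Section Forms.
Variables (R : realType) (M : manifold R) (E : M -> lmodType R).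
Variable S : lsubspace (dprod E).

(** A field of alternating k-forms on the fibres of E is smooth when its
    values on the cross-sections in S are smooth functions. *)
Definition smooth_form k (Phi : dprod (fun x => alt (E x) k)) :=
  forall xi : 'I_k -> sub_of S,
    smooth_on setT (fun x => sub_val (Phi x) (fun i => sub_val (xi i) x)).

Fact smooth_form0 k : smooth_form (0 : dprod (fun x => alt (E x) k)).
Proof. by move=> xi; exact: smooth_on_cst. Qed.
Fact smooth_formP k a (Phi Psi : dprod (fun x => alt (E x) k)) :
  smooth_form Phi -> smooth_form Psi -> smooth_form (a *: Phi + Psi).
Proof. by move=> sP sQ xi; exact (smooth_onP a openT (sP xi) (sQ xi)). Qed.
Definition form_space k : lsubspace (dprod (fun x => alt (E x) k)) :=
  LSubspace (@smooth_form0 k) (@smooth_formP k).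
Definition form k : lmodType R := sub_of (form_space k).

Definition form_val k (Phi : form k) x (w : 'I_k -> E x) : R :=
  sub_val (sub_val Phi x) w.

Definition pairing k (Phi : form k) (xi : 'I_k -> sub_of S) : Cinf M :=
  mk_sub (W := smooth_fun_space M) (sub_ofP Phi xi).

Lemma pairingP k a (Phi Psi : form k) xi :
  pairing (a *: Phi + Psi) xi = a *: pairing Phi xi + pairing Psi xi.
Proof. exact: sub_val_inj. Qed.
Lemma pairing0 k xi : pairing (0 : form k) xi = 0.
Proof. exact: sub_val_inj. Qed.

Definition form_mul k l (Phi : form k) (Psi : form l) (Theta : form (k + l)) :=
  forall x w, form_val Theta w = wedge (sub_val Phi x) (sub_val Psi x) w.
Definition form_one (Phi : form 0) := forall x (w : 'I_0 -> E x), form_val Phi w = 1.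
End Forms.

Section LieAlgebroidForms.
Variables (R : realType) (M : manifold R) (L : lie_algebroid M).

Definition Omega k : lmodType R := form (sections L) k.

(** [is_d Phi Phi'] means that [Phi'] is the differential of [Phi]. In the
    second sum i < j, so that [lift j i] has value i and
    [xi \o lift j \o lift i] omits the arguments of index i and j. *)
Definition is_d k (Phi : Omega k) (Phi' : Omega k.+1) :=
  forall xi : 'I_k.+1 -> Gamma L,
    pairing Phi' xi =
    \sum_(i < k.+1) (-1) ^+ i *:
      vf_apply (anchor_vf (xi i)) (pairing Phi (xi \o lift i)) +
    \sum_(j < k.+1) \sum_(i < k | (i < j)%N) (-1) ^+ (i + j) *:
      pairing Phi (consf (bracket (xi (lift j i)) (xi j))
                         (xi \o lift j \o lift i)).

Fact is_d0 k : @is_d k 0 0.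
Proof.
move=> xi; rewrite pairing0 !big1 ?addr0// => [j _|i _].
  by rewrite big1// => i _; rewrite pairing0 scaler0.
by rewrite pairing0 vf_apply0 scaler0.
Qed.
Fact is_dP k a (u : Omega k) u' v v' :
  is_d u u' -> is_d v v' -> is_d (a *: u + v) (a *: u' + v').
Proof.
move=> du dv xi; rewrite pairingP du dv scalerDr addrACA !scaler_sumr.
congr (_ + _); rewrite -big_split/=; apply: eq_bigr => i _.
  by rewrite pairingP vf_applyP scalerDr !scalerA mulrC.
rewrite scaler_sumr -big_split/=; apply: eq_bigr => j _.
by rewrite pairingP scalerDr !scalerA mulrC.
Qed.

Definition Omega_algebra : cochain_algebra R :=
  @CochainAlgebra R Omega is_d is_d0 is_dP
    (@form_mul _ _ _ (sections L)) (@form_one _ _ _ (sections L)).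
End LieAlgebroidForms.

Section Pair.
Variables (R : realType) (M : manifold R) (A : lie_algebroid M).
Variable B : lie_subalgebroid A.

Definition in_h x (v : isotropy A x) :=
  exists b : isotropy B x, sub_val v = sub_incl B x (sub_val b).
Fact in_h0 x : @in_h x 0.
Proof. by exists 0; rewrite linear0. Qed.
Fact in_hP x a (u v : isotropy A x) : in_h u -> in_h v -> in_h (a *: u + v).
Proof.
move=> [b ub] [c vc]; exists (a *: b + c).
by rewrite sub_valD sub_valZ ub vc -linearP.
Qed.
Definition h_space x : lsubspace (isotropy A x) :=
  @LSubspace _ _ (@in_h x) (@in_h0 x) (@in_hP x).

Definition normal x : lmodType R := quot_by (h_space x).
Definition nclass x (v : isotropy A x) : normal x := quot_class (h_space x) v.

(** The cross-sections of g/h are the classes of those of g. *)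
Definition is_nsection (q : dprod normal) :=
  exists nu : Gamma_ker A, forall x, q x = nclass (ker_val nu x).
Fact is_nsection0 : is_nsection 0.
Proof. by exists 0 => x; congr nclass; exact: sub_val_inj. Qed.
Fact is_nsectionP a p q :
  is_nsection p -> is_nsection q -> is_nsection (a *: p + q).
Proof.
move=> [mu pmu] [nu qnu]; exists (a *: mu + nu) => x.
rewrite (_ : ker_val _ x = a *: ker_val mu x + ker_val nu x); last first.
  exact: sub_val_inj.
change (a *: p x + q x = nclass (a *: ker_val mu x + ker_val nu x)).
by rewrite pmu qnu /nclass linearP.
Qed.
Definition nsections : lsubspace (dprod normal) :=
  LSubspace is_nsection0 is_nsectionP.

Definition nsec (nu : Gamma_ker A) : sub_of nsections :=
  mk_sub (W := nsections) (ex_intro _ nu (fun x => erefl)).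

Definition nform k : lmodType R := form nsections k.

Definition is_invariant k (Psi : nform k) :=
  forall (xi : Gamma B) (nu : 'I_k -> Gamma_ker A),
    vf_apply (anchor_vf xi) (pairing Psi (nsec \o nu)) =
    \sum_(j < k) (-1) ^+ j *: pairing Psi
      (nsec \o consf (bracket_ker (sec_map (sub_incl B) xi) (nu j)) (nu \o lift j)).

Fact is_invariant0 k : @is_invariant k 0.
Proof.
move=> xi nu; rewrite pairing0 vf_apply0 big1// => j _.
by rewrite pairing0 scaler0.
Qed.
Fact is_invariantP k a (Phi Psi : nform k) :
  is_invariant Phi -> is_invariant Psi -> is_invariant (a *: Phi + Psi).
Proof.
move=> iP iQ xi nu; rewrite pairingP vf_applyP iP iQ scaler_sumr -big_split/=.
by apply: eq_bigr => j _; rewrite pairingP scalerDr !scalerA mulrC.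
Qed.
Definition invariants k : lsubspace (nform k) :=
  LSubspace (@is_invariant0 k) (@is_invariantP k).
Definition inv_form k : lmodType R := sub_of (invariants k).

(** Indices start at 0, which does not change the parity of i + j. *)
Definition is_delta_bar k (Psi : inv_form k) (Psi' : inv_form k.+1) :=
  forall nu : 'I_k.+1 -> Gamma_ker A,
    pairing (sub_val Psi') (nsec \o nu) =
    \sum_(j < k.+1) \sum_(i < k | (i < j)%N) (-1) ^+ (i + j + 1) *:
      pairing (sub_val Psi)
        (nsec \o consf (bracket_ker (sub_val (nu (lift j i))) (nu j))
                       (nu \o lift j \o lift i)).

Fact is_delta_bar0 k : @is_delta_bar k 0 0.
Proof.
move=> nu; rewrite pairing0 big1// => j _.
by rewrite big1// => i _; rewrite pairing0 scaler0.
Qed.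
Fact is_delta_barP k a (u : inv_form k) u' v v' :
  is_delta_bar u u' -> is_delta_bar v v' ->
  is_delta_bar (a *: u + v) (a *: u' + v').
Proof.
move=> du dv nu; rewrite pairingP du dv scaler_sumr -big_split/=.
apply: eq_bigr => j _; rewrite scaler_sumr -big_split/=.
by apply: eq_bigr => i _; rewrite pairingP scalerDr !scalerA mulrC.
Qed.

(** The cochain algebra whose cohomology is H(g, B). *)
Definition inv_algebra : cochain_algebra R :=
  @CochainAlgebra R inv_form is_delta_bar is_delta_bar0 is_delta_barP
    (fun k l Phi Psi Theta =>
       form_mul (sub_val Phi) (sub_val Psi) (sub_val Theta))
    (fun Phi => form_one (sub_val Phi)).
End Pair.

Section Delta.
Variables (R : realType) (M : manifold R) (F : foliation M).
Variables (A : lie_algebroid M) (B : lie_subalgebroid A).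
Hypothesis AF : over_foliation A F.
Variable lambda : splitting F B.
Variables (L : lie_algebroid M) (nabla : connection L A).

Definition anchor_fol x (a : A x) : sub_of (F x) :=
  mk_sub (W := F x) (iffRL (@AF x _) (ex_intro _ a erefl)).

Definition breve x (a : A x) : A x := a - sub_incl B x (lambda x (anchor_fol a)).

Lemma breve_isotropy x (a : A x) : isotropy_space A x (breve a).
Proof.
by rewrite /isotropy_space /= linearB incl_anchor split_anchor subrr.
Qed.
Definition breve_lambda x (a : A x) : isotropy A x :=
  mk_sub (W := isotropy_space A x) (breve_isotropy a).

Definition omega x (w : L x) : normal B x :=
  nclass B (- breve_lambda (nabla x w)).

Lemma omega_linear x : linear (@omega x).
Proof.
move=> a u v; rewrite /omega /nclass -linearP; congr quot_class.
apply: sub_val_inj; rewrite sub_valD sub_valZ !sub_valN /= /breve.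
rewrite (_ : anchor_fol (nabla x (a *: u + v)) =
  a *: anchor_fol (nabla x u) + anchor_fol (nabla x v)).
  rewrite (linearP (nabla x)) (linearP (lambda x)) (linearP (sub_incl B x)).
  rewrite scalerN -[RHS]opprD scalerBr; congr (- _).
  by rewrite opprD addrACA.
by apply: sub_val_inj; rewrite sub_valD sub_valZ /= !linearP.
Qed.

Definition omega_sec (s : Gamma L) (x : M) : A x := breve (nabla x (sub_val s x)).
Lemma omega_smooth (s : Gamma L) : smooth_sec (fun x => - omega_sec s x).
Proof.
have sN := bmap_smooth nabla s.
have sF : smooth_vf
    (fun x => sub_val (anchor_fol (nabla x (sub_val s x)))).
  exact: (anchor_smooth (sec_map nabla s)).
have sB := split_smooth lambda sF.
have sj := bmap_smooth (sub_incl B) (mk_sub (W := sections B) sB).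
pose p : dprod A := fun x => nabla x (sub_val s x).
pose q : dprod A := fun x =>
  sub_incl B x (lambda x (anchor_fol (nabla x (sub_val s x)))).
suff -> : (fun x => - omega_sec s x) = (-1 *: p + q : dprod A).
  exact (smooth_secP (-1) sN sj).
apply: functional_extensionality_dep => x; symmetry.
change (-1 *: nabla x (sub_val s x) +
  sub_incl B x (lambda x (anchor_fol (nabla x (sub_val s x)))) = - omega_sec s x).
by rewrite scaleN1r /omega_sec /breve opprB addrC.
Qed.

Lemma omega_nsection (s : Gamma L) : is_nsection (fun x => omega (sub_val s x)).
Proof.
have kers : ker_sections A (mk_sub (W := sections A) (omega_smooth s)).
  by move=> x; apply: (@lsubspaceN _ _ (isotropy_space A x)); exact: breve_isotropy.
exists (mk_sub (W := ker_sections A) kers) => x.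
by rewrite /omega; congr nclass; exact: sub_val_inj.
Qed.

Lemma Delta_alternating k (Psi : nform B k) x :
  is_alternating (fun w : 'I_k -> L x =>
    form_val Psi (fun i => omega (w i)) : R^o).
Proof.
have [lP aP] := sub_ofP (sub_val Psi x).
have upd (w : 'I_k -> L x) i v : (fun j => omega (update w i v j)) =
    update (fun j => omega (w j)) i (omega v).
  by apply/funext => j; rewrite /update; case: ifP.
split=> [w i a u v|w i j ij wij].
  by rewrite !upd omega_linear /form_val lP.
by rewrite /form_val (aP _ i j)// wij.
Qed.

Lemma Delta_smooth k (Psi : nform B k) :
  smooth_form (sections L)
    (fun x => mk_sub (W := alt_space (L x) k) (Delta_alternating Psi x)).
Proof.
move=> xi.
exact: (sub_ofP Psi (fun i => mk_sub (W := nsections B) (omega_nsection (xi i)))).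
Qed.

Definition Delta_form k (Psi : nform B k) : Omega L k :=
  mk_sub (W := form_space (sections L) k) (Delta_smooth Psi).

Definition Delta k (Psi : inv_algebra B k) : Omega_algebra L k :=
  Delta_form (sub_val Psi).
End Delta.

(* Main.v *)
(** Write [w_i] for the arguments of a form on [L]. The splitting gives
    [nabla w_i = j b_i - nu_i] with [b_i] a section of [B] lifting the anchor of
    [w_i] and [nu_i] a section of [ker #_A] whose class is [omega w_i].
    Flatness of [nabla] yields, modulo [ker #_B],
      [omega [w_i, w_j] = [b_i, nu_j] - [b_j, nu_i] - [nu_i, nu_j]].
    In the differential of [Delta Psi], the anchor of [w_i] acts as that of
    [b_i], so by invariance of [Psi] the first sum becomes one of the terms
    [Psi ([b_i, nu_j], ...)]; these cancel the mixed brackets above and what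
    remains is the differential of [Psi] evaluated on the [nu_i]. Hence [Delta]
    is a morphism of cochain algebras. *)
Require Import Defs.
From HB Require Import structures.
From mathcomp Require Import reals.
From mathcomp Require Import all_boot all_algebra boolp classical_sets functions topology zify.
Import GRing.Theory.
Set Implicit Arguments.
Unset Strict Implicit.
Unset Printing Implicit Defensive.
Local Open Scope ring_scope.

(** * Maps induced in cohomology *)

Lemma chain_map_induces_hom (K : pzRingType) (C D : cochain_algebra K)
    (Delta : forall k, C k -> D k) :
  (forall k a u v, Delta k (a *: u + v) = a *: Delta k u + Delta k v) ->
  (forall k u v, @cd K C k u v -> @cd K D k (Delta k u) (Delta k.+1 v)) ->
  (forall k l u v w, @cmul K C k l u v w ->
    @cmul K D k l (Delta k u) (Delta l v) (Delta (k + l)%N w)) ->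
  (forall u, @cone K C u -> @cone K D (Delta 0 u)) ->
  induces_hom Delta.
Proof.
move=> DeltaP Delta_d Delta_mul Delta_one.
have Delta0 k : Delta k 0 = 0.
  by have := DeltaP k (-1) 0 0; rewrite scaler0 addr0 scaleN1r addNr.
have Delta_cocycle k (z : cocycle C k) : cocycles D k (Delta k (sub_val z)).
  by have := Delta_d k _ _ (sub_ofP z); rewrite Delta0.
pose Dz k (z : cocycle C k) : cocycle D k := mk_sub (Delta_cocycle k z).
have DzP k a u v : Dz k (a *: u + v) = a *: Dz k u + Dz k v.
  exact/sub_val_inj/DeltaP.
have Dz_coboundary k z : coboundaries C k z -> coboundaries D k (Dz k z).
  (* In degree 0 the only coboundary is 0, so it suffices that [Delta] kills 0. *)
  case: k z => [|k] z /=; first by move=> ->; exact: Delta0.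
  by move=> [t dt]; exists (Delta k t); exact: Delta_d.
have Dz_class k u v : coclass u = coclass v -> coclass (Dz k u) = coclass (Dz k v).
  move=> /quot_eqP uv; apply/quot_eqP.
  have -> : Dz k u - Dz k v = Dz k (-1 *: v + u) by rewrite DzP scaleN1r addrC.
  by rewrite scaleN1r addrC; exact: Dz_coboundary.
pose h k (c : cohomology C k) : cohomology D k := coclass (Dz k (quot_repr c)).
have hE k z : h k (coclass z) = coclass (Dz k z).
  by apply: Dz_class; exact: quot_reprK.
have h_linear k : linear (h k).
  move=> a c d; rewrite -(quot_reprK c) -(quot_reprK d) -linearP.
  by rewrite !hE DzP /coclass linearP.
pose H k : {linear cohomology C k -> cohomology D k} :=
  HB.pack (h k) (GRing.isLinear.Build K _ _ _ (h k) (h_linear k)).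
exists H; split=> [k z|k l c d e [z [z' [z'' [<- <- <- zz]]]]|c [z <- z1]].
- by exists (Dz k z); split=> //; exact: hE.
- exists (Dz k z), (Dz l z'), (Dz _ z''); split; rewrite -?hE //.
  exact: Delta_mul.
- by exists (Dz 0 z); [rewrite -hE|exact: Delta_one].
Qed.

(** * Sums over pairs of distinct indices *)

Lemma big_lift (V : nmodType) n (j : 'I_n.+1) (P : pred 'I_n.+1) (F : 'I_n.+1 -> V) :
  \sum_(i < n | P (lift j i)) F (lift j i) = \sum_(m | P m && (m != j)) F m.
Proof.
symmetry; rewrite (reindex_omap (lift j) (unlift j)) /=; last first.
  by move=> m /andP[_]; rewrite eq_sym => /unlift_some[i -> ->].
by apply: eq_bigl => i; rewrite liftK eqxx eq_sym neq_lift !andbT.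
Qed.

(** Both sides run over ordered pairs of distinct indices; the right one groups the two orders of
    each pair under its larger index [j]. *)
Lemma big_ord_pairs (V : nmodType) n (H : 'I_n.+1 -> 'I_n.+1 -> V) :
  \sum_(p < n.+1) \sum_(q < n) H p (lift p q) =
  \sum_(j < n.+1) \sum_(i < n | (i < j)%N) (H j (lift j i) + H (lift j i) j).
Proof.
transitivity (\sum_(p < n.+1) \sum_(m < n.+1 | (m < p)%N) (H p m + H m p)); last first.
  apply: eq_bigr => j _.
  rewrite (eq_bigl (fun i : 'I_n => (lift j i < j)%N)); last first.
    by move=> i /=; rewrite /bump; case: leqP => /=; lia.
  rewrite (big_lift j (fun m : 'I_n.+1 => (m < j)%N) (fun m => H j m + H m j)).
  by apply: eq_bigl => m; rewrite -val_eqE; case: ltngtP.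
under [RHS]eq_bigr do rewrite big_split.
(* After the exchange the second half supplies, for each [p], the indices [m > p]. *)
rewrite big_split/= [X in _ = _ + X](exchange_big_dep predT)//= -big_split/=.
apply: eq_bigr => p _.
rewrite (big_lift p predT (H p)) (bigID (fun m : 'I_n.+1 => (m < p)%N))/=.
by congr (_ + _); apply: eq_bigl => m; rewrite -val_eqE; case: ltngtP.
Qed.

(** The increasing enumeration of the complement of [{p, m}], for [p != m]. *)
Definition skip2 n (p m : 'I_n.+1) (x : 'I_n.-1) : 'I_n.+1 :=
  inord (bump (maxn p m) (bump (minn p m) x)).

(** This symmetry lets the terms of [(p, m)] and [(m, p)] share their remaining arguments, which the
    form [lift p \o lift q] hides. *)
Lemma skip2C n (p m : 'I_n.+1) : skip2 p m = skip2 m p.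
Proof. by apply/funext => x; rewrite /skip2 maxnC minnC. Qed.

Lemma skip2_lift n (p : 'I_n.+1) (q : 'I_n) :
  skip2 p (lift p q) = lift p \o lift q.
Proof.
apply/funext => x; apply: val_inj; rewrite /= inordK.
  by rewrite /= /bump; do 4!case: leqP => /=; lia.
by have := ltn_ord p; have := ltn_ord q; have := ltn_ord x; rewrite /= /bump; lia.
Qed.

(** Multilinearity is stated through [update]; this makes it available in the first argument of
    [consf]. The value [u] is an arbitrary filler. *)
Lemma consf_update (K : comNzRingType) (V : lmodType K) k (u v : V) (w : 'I_k -> V) :
  consf (k := k.+1) v w = update (consf (k := k.+1) u w) ord0 v.
Proof.
apply/funext => -[[|i] lti]; rewrite /update -val_eqE //= /consf /=.
by case: insubP => //; rewrite -ltnS lti.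
Qed.

Lemma comp_consf (T T' : Type) (f : T -> T') k v (w : 'I_k.-1 -> T) :
  (fun i : 'I_k => f (consf v w i)) = consf (f v) (f \o w).
Proof. by apply/funext => -[[|i] lti] //=; rewrite /consf/=; case: insub. Qed.

Lemma form_val_consfB (R : realType) (M : manifold R) (E : M -> lmodType R)
    (S : lsubspace (dprod E)) k (Phi : Defs.form S k) x u v (w : 'I_k.-1 -> E x) :
  (0 < k)%N ->
  form_val Phi (consf (u - v) w) = form_val Phi (consf u w) - form_val Phi (consf v w).
Proof.
case: k Phi w => // k Phi w _.
have [lPhi _] := sub_ofP (sub_val Phi x).
rewrite (consf_update 0 (u - v)) (consf_update 0 u) (consf_update 0 v) /form_val.
by rewrite addrC -scaleN1r lPhi scaleN1r addrC.
Qed.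

Lemma ker_valB (R : realType) (M : manifold R) (A : lie_algebroid M)
    (mu nu : Gamma_ker A) x : ker_val (mu - nu) x = ker_val mu x - ker_val nu x.
Proof. exact: sub_val_inj. Qed.

(** * Flat connections and the chain map property *)

Section BreveSplitting.
Variables (R : realType) (M : manifold R) (F : foliation M).
Variables (A : lie_algebroid M) (B : lie_subalgebroid A).
Variables (AF : over_foliation A F) (lambda : splitting F B).
Variables (L : lie_algebroid M) (nabla : connection L A).

(** The two representatives differ by the image of [lambda (#a) - b], which lies in the kernel of
    the anchor of [B] because [a] and [b] have the same anchor. *)
Lemma breve_class x (a : A x) (b : B x) (u : isotropy A x) :
  a = sub_incl B x b - sub_val u ->
  nclass B (- breve_lambda AF lambda a) = nclass B u.
Proof.
move=> aE; apply/quot_eqP.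
set c := lambda x (anchor_fol AF a) - b.
have c0 : isotropy_space B x c.
  rewrite /isotropy_space /= linearB split_anchor /= aE linearB incl_anchor.
  by rewrite (sub_ofP u) subr0 subrr.
exists (mk_sub c0); rewrite /= /breve {1}aE opprB opprB addrA /c linearB.
by rewrite addrAC addrK.
Qed.

Definition lift_sec (s : Gamma L) : Gamma B :=
  mk_sub (W := sections B)
    (split_smooth lambda (X := fun x => anchor_fol AF (nabla x (sub_val s x)))
      (anchor_smooth (sec_map nabla s))).

Lemma omega_ker_subproof (s : Gamma L) :
  ker_sections A
    (mk_sub (W := sections A) (@omega_smooth R M F A B AF lambda L nabla s)).
Proof.
by move=> x; apply: (@lsubspaceN _ _ (isotropy_space A x)); exact: breve_isotropy.
Qed.

Definition omega_ker (s : Gamma L) : Gamma_ker A :=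
  mk_sub (omega_ker_subproof s).

Lemma omegaE (s : Gamma L) x :
  omega AF lambda nabla (sub_val s x) = nclass B (ker_val (omega_ker s) x).
Proof. by rewrite /omega; congr nclass; exact: sub_val_inj. Qed.

Lemma sec_map_split (s : Gamma L) :
  sec_map nabla s = sec_map (sub_incl B) (lift_sec s) - sub_val (omega_ker s).
Proof.
apply: sub_val_inj; apply: functional_extensionality_dep => x.
change (nabla x (sub_val s x) =
  sub_incl B x (lambda x (anchor_fol AF (nabla x (sub_val s x)))) -
  - breve AF lambda (nabla x (sub_val s x))).
by rewrite opprK /breve addrC subrK.
Qed.

Lemma anchor_lift_sec (s : Gamma L) : anchor_vf (lift_sec s) = anchor_vf s.
Proof.
apply: sub_val_inj; apply: functional_extensionality_dep => x.
by rewrite /= split_anchor /= conn_anchor.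
Qed.

(** The right side is grouped to fit the hypothesis of [breve_class]. *)
Lemma bracketB (s t u v : Gamma A) : bracket (s - t) (u - v) =
  bracket s u - (bracket s v - bracket u t - bracket t v).
Proof.
have subr z w w' : bracket z (w - w') = bracket z w - bracket z w' :> Gamma A.
  by rewrite bracketDr bracketNr.
have subl z w w' : bracket (w - w') z = bracket w z - bracket w' z :> Gamma A.
  by rewrite bracketC subr opprB (bracketC z w) (bracketC z w') opprK addrC.
rewrite subl !subr (bracketC u t) opprK -addrA; congr (_ + _).
by rewrite !opprD !opprK addrA.
Qed.

Lemma omega_bracket (s t : Gamma L) x : flat nabla ->
  omega AF lambda nabla (sub_val (bracket s t) x) =
  nclass B (ker_val
    (bracket_ker (sec_map (sub_incl B) (lift_sec s)) (omega_ker t) -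
     bracket_ker (sec_map (sub_incl B) (lift_sec t)) (omega_ker s) -
     bracket_ker (sub_val (omega_ker s)) (omega_ker t)) x).
Proof.
move=> flat_nabla;
(* The bracket of the two lifts stays in [B], so it does not affect the class. *)
apply: (breve_class (b := sub_val (bracket (lift_sec s) (lift_sec t)) x)).
have := flat_nabla s t; rewrite (sec_map_split s) (sec_map_split t) bracketB -incl_bracket.
by move/(congr1 (fun u : Gamma A => sub_val u x)).
Qed.

Lemma pairing_Delta k (Psi : nform B k) (xi : 'I_k -> Gamma L) :
  pairing (Delta_form AF lambda nabla Psi) xi =
  pairing Psi (nsec B \o (omega_ker \o xi)).
Proof.
apply: sub_val_inj; apply/funext => x.
by congr (form_val Psi); apply/funext => i; exact: omegaE.
Qed.

Lemma Delta_chain k (Psi : inv_form B k) (Psi' : inv_form B k.+1) : flat nabla ->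
  is_delta_bar Psi Psi' ->
  is_d (Delta_form AF lambda nabla (sub_val Psi))
    (Delta_form AF lambda nabla (sub_val Psi')).
Proof.
move=> flat_nabla dPsi xi; rewrite pairing_Delta dPsi.
pose nu i := omega_ker (xi i).
pose jb i := sec_map (sub_incl B) (lift_sec (xi i)).
pose Q (eta : Gamma_ker A) w : Cinf M :=
  pairing (sub_val Psi) (nsec B \o consf eta w).
(* For [m != p], [unbump p m] is the position of [m] once [p] is omitted, hence the sign given by
   invariance. *)
pose H (p m : 'I_k.+1) := (-1) ^+ (p + unbump p m) *:
  Q (bracket_ker (jb p) (nu m)) (nu \o skip2 p m).
have invQ (i : 'I_k.+1) : (-1) ^+ i *: vf_apply (anchor_vf (xi i))
    (pairing (Delta_form AF lambda nabla (sub_val Psi)) (xi \o lift i)) =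
    \sum_(q < k) H i (lift i q).
  rewrite pairing_Delta -anchor_lift_sec (sub_ofP Psi) scaler_sumr.
  by apply: eq_bigr => q _; rewrite scalerA -exprD /H bumpK skip2_lift.
(* All sums now run over pairs [i < j], and the identity is checked pair by pair. *)
rewrite (eq_bigr _ (fun i _ => invQ i)) big_ord_pairs -big_split /=.
apply: eq_bigr => j _; rewrite -big_split /=; apply: eq_bigr => i ij.
have dQ : pairing (Delta_form AF lambda nabla (sub_val Psi))
    (consf (bracket (xi (lift j i)) (xi j)) (xi \o lift j \o lift i)) =
    Q (bracket_ker (jb (lift j i)) (nu j)) (nu \o lift j \o lift i) -
    Q (bracket_ker (jb j) (nu (lift j i))) (nu \o lift j \o lift i) -
    Q (bracket_ker (sub_val (nu (lift j i))) (nu j)) (nu \o lift j \o lift i).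
  apply: sub_val_inj; apply/funext => x.
  have QE eta w : (sub_val (Q eta w) : M -> R) x =
      form_val (sub_val Psi) (consf (nclass B (ker_val eta x))
                                    (fun l => nclass B (ker_val (w l) x))).
    by congr form_val; exact: comp_consf (fun e => nclass B (ker_val e x)) _ _ _.
  (* The index [i : 'I_k] guarantees a first argument in which to be linear. *)
  have k_gt0 : (0 < k)%N by exact: leq_ltn_trans (ltn_ord i).
  change (form_val (sub_val Psi) (fun l => omega AF lambda nabla (sub_val
      (consf (bracket (xi (lift j i)) (xi j)) (xi \o lift j \o lift i) l) x)) =
    sub_val (Q (bracket_ker (jb (lift j i)) (nu j)) (nu \o lift j \o lift i)) x -
    sub_val (Q (bracket_ker (jb j) (nu (lift j i))) (nu \o lift j \o lift i)) x -
    sub_val (Q (bracket_ker (sub_val (nu (lift j i))) (nu j))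
      (nu \o lift j \o lift i)) x :> R).
  rewrite !QE -!form_val_consfB//.
  rewrite (comp_consf (fun e : Gamma L => omega AF lambda nabla (sub_val e x))).
  rewrite omega_bracket //; congr form_val; congr consf; last first.
    by apply/funext => l; exact: omegaE.
  by rewrite !ker_valB /nclass !linearB.
have vi : lift j i = i :> nat by rewrite /= /bump leqNgt ij.
rewrite dQ /H skip2C [skip2 _ j]skip2C skip2_lift bumpK vi.
(* Since [i < j], omitting [i] moves [j] down by one: the two mixed terms get opposite signs and
   cancel those of [dQ]. *)
have -> : (i + j = (i + unbump i j).+1)%N by rewrite /unbump ij; lia.
have -> : (j + i = (i + unbump i j).+1)%N by rewrite /unbump ij; lia.
rewrite addn1 !exprS !mulN1r opprK; set s := (-1) ^+ _.
set w := (nu \o lift j) \o lift i.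
set X := Q (bracket_ker (jb (lift j i)) (nu j)).
set Y := Q (bracket_ker (jb j) (nu (lift j i))).
set Z := Q (bracket_ker _ (nu j)).
change (s *: Z w = - s *: Y w + s *: X w + - s *: (X w - Y w - Z w)).
rewrite !scaleNr !scalerBr !opprB addrC.
by rewrite [- (s *: Y w) + _]addrC -(opprB (s *: Y w)) addrK.
Qed.
End BreveSplitting.

Lemma Delta_induces_hom (R : realType) (M : manifold R) (F : foliation M)
    (A : lie_algebroid M) (B : lie_subalgebroid A) (AF : over_foliation A F)
    (lambda : splitting F B) (L : lie_algebroid M) (nabla : connection L A) :
  flat nabla -> induces_hom (@Delta R M F A B AF lambda L nabla).
Proof.
move=> flat_nabla; apply: chain_map_induces_hom.
- by move=> k a u v; apply: sub_val_inj; apply: functional_extensionality_dep => x;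
    exact: sub_val_inj.
- by move=> k u v; exact: Delta_chain.
(* [Delta] is precomposition with [omega] at each point, so the wedge formula is simply evaluated on
   the images under [omega]. *)
- by move=> k l u v w uvw x z; exact: uvw.
- by move=> u u1 x z; exact: u1.
Qed.

Theorem corollary1 (R : realType) (M : manifold R) (F : foliation M)
    (A : lie_algebroid M) (B : lie_subalgebroid A)
    (regA : regular_algebroid A) (regB : regular_algebroid B)
    (AF : over_foliation A F) (BF : over_foliation B F)
    (lambda : splitting F B)
    (L : lie_algebroid M) (nabla : connection L A) (flat_nabla : flat nabla) :
  induces_hom (@Delta R M F A B AF lambda A (id_conn A)) /\
  induces_hom (@Delta R M F A B AF lambda L nabla).
Proof.
split; apply: Delta_induces_hom => //.
(* What remains is the flatness of the identity connection. *)
have sec_map_id s : sec_map (id_conn A) s = s by exact: sub_val_inj.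
by move=> s t; rewrite !sec_map_id.
Qed.
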